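(* Let $d\ge 3$ and $k\ge3$ be integers with $(d,k)\neq(3,4)$, and let $C_k$ be the cycle of length $k$. Then the ortho-homomorphism density $t(C_k,d)$ is finite.
   Context: For these values of $(d,k)$, $C_k$ is $d$-sparse (it contains no subgraph $K_{a,b}$ with $a,b\ge1$, $a+b>d$). $S^{d-1}$ is the unit sphere of $\mathbb{R}^d$, $A_k$ the surface area of $S^k\subset\mathbb{R}^{k+1}$, and $\mathrm{Det}(y_1,\dots,y_m)=\sqrt{\det((y_i^{\top}y_j)_{i,j})}$ ($=1$ for the empty family). For a $d$-sparse graph $G=(V,E)$ and an ordering $p:V\to\{1,\dots,|V|\}$, let $N_p(v)=\{w:vw\in E,\ p(w)<p(v)\}$, $d_p(v)=|N_p(v)|$, $x_p(v)=(x_w:w\in N_p(v))$, and let $\rho_p$ be the distribution on $(S^{d-1})^V$ of the random sequential ortho-homomorphism (process nodes in increasing $p$, choosing $x_v$ uniformly on the sphere $\{y\in S^{d-1}:y\perp x_w\ \forall w\in N_p(v)\}$). Then $t(G,d)=\int\frac{A_{d-1}^{|E|-|V|}}{A_{d-2}^{|E|}}\prod_{v\in V}\frac{A_{d-d_p(v)-1}}{\mathrm{Det}(x_p(v))}\,d\rho_p(x)\in(0,\infty]$, independent of $p$. *)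

(* Defs.v *)
From HB Require Import structures.
From mathcomp Require Import all_boot all_order all_algebra.
From mathcomp Require Import all_classical all_reals all_analysis.

Set Implicit Arguments.
Unset Strict Implicit.
Unset Printing Implicit Defensive.

Import Order.TTheory GRing.Theory Num.Theory.
Import numFieldNormedType.Exports.
Local Open Scope classical_set_scope.
Local Open Scope ring_scope.

Definition dotv {R : realType} {d : nat} (x y : 'rV[R]_d) : R := (x *m y^T) 0 0.

Definition Det {R : realType} {d : nat} (ys : seq 'rV[R]_d) : R :=
  Num.sqrt (\det (\matrix_(i < size ys, j < size ys) dotv ys`_i ys`_j)).

(** A_k = surface area of the unit sphere S^k of R^(k+1):
    A_0 = 2, A_1 = 2 pi, A_(k+2) = 2 pi / (k+1) * A_k
    (equivalently A_k = 2 pi^((k+1)/2) / Gamma((k+1)/2)). *)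
Fixpoint sphere_area {R : realType} (k : nat) : R :=
  match k with
  | 0 => 2
  | 1 => 2 * pi
  | k'.+2 => 2 * pi / k'.+1%:R * sphere_area k'
  end.

Notation Rd R d := (g_sigma_algebraType (@open 'rV[R]_d)).

Definition orth_sphere {R : realType} {d : nat} (ys : seq 'rV[R]_d) : set (Rd R d) :=
  [set x : 'rV[R]_d | dotv x x = 1 /\ (forall y, y \in ys -> dotv x y = 0)].

(** mu is the uniform (rotation-invariant) probability distribution on the
    unit sphere of span(ys)^perp: it is concentrated on that sphere and is
    invariant under every orthogonal map of R^d fixing each vector of ys
    (these maps act transitively on the sphere, so this characterizes the
    uniform distribution uniquely). *)
Definition uniform_on_orth_sphere {R : realType} {d : nat} (ys : seq 'rV[R]_d)
    (mu : probability (Rd R d) R) : Prop :=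
  mu (orth_sphere ys) = 1%E /\
  forall Q : 'M[R]_d, Q *m Q^T = 1%:M -> (forall y, y \in ys -> y *m Q = y) ->
    forall A : set (Rd R d), measurable A ->
      mu [set x : Rd R d | x *m Q \in A] = mu A.

(** A family of uniform distributions, one for each family ys of fewer than d
    vectors (the only ones needed for d-sparse graphs). *)
Definition uniform_family {R : realType} {d : nat}
    (sigma : seq 'rV[R]_d -> probability (Rd R d) R) : Prop :=
  forall ys : seq 'rV[R]_d, (size ys < d)%N -> uniform_on_orth_sphere ys (sigma ys).

Definition prev_nbrs {R : realType} {d : nat} (E : rel nat) (v : nat)
    (xs : seq 'rV[R]_d) : seq 'rV[R]_d :=
  [seq xs`_w | w <- iota 0 v & E v w].

(** Integral of F against the random sequential ortho-homomorphism rho_p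
    (vertices processed in the order 0,1,...,n-1; x_v drawn from
    sigma (x_p(v))).  [seq_orth_int sigma E m xs F] integrates out the
    remaining m vertices given the already chosen prefix xs. *)
Fixpoint seq_orth_int {R : realType} {d : nat}
    (sigma : seq 'rV[R]_d -> probability (Rd R d) R) (E : rel nat) (m : nat)
    (xs : seq 'rV[R]_d) (F : seq 'rV[R]_d -> \bar R) : \bar R :=
  match m with
  | 0 => F xs
  | m'.+1 =>
      (\int[sigma (prev_nbrs E (size xs) xs)]_(y in [set: Rd R d])
         seq_orth_int sigma E m' (rcons xs y) F)%E
  end.

Definition nedges (E : rel nat) (n : nat) : nat :=
  #|[set p : 'I_n * 'I_n | ((p.1 < p.2)%N && E p.1 p.2)]|.

Definition ortho_integrand {R : realType} (d : nat) (E : rel nat) (n : nat)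
    (xs : seq 'rV[R]_d) : \bar R :=
  ((((sphere_area d.-1 : R) ^ ((nedges E n)%:Z - n%:Z)
      / (sphere_area d.-2 : R) ^+ nedges E n)%:E) *
   \prod_(v < n)
     (let ys := prev_nbrs E v xs in
      if Det ys == 0%R then +oo
      else ((sphere_area (d - size ys).-1 : R) / Det ys)%:E))%E.

(** t(G,d) for the graph G = ({0..n-1}, E), computed with the ordering p = id
    and the family sigma of uniform sphere distributions. *)
Definition ortho_density {R : realType} (d : nat)
    (sigma : seq 'rV[R]_d -> probability (Rd R d) R) (E : rel nat) (n : nat)
    : \bar R :=
  seq_orth_int sigma E n [::] (@ortho_integrand R d E n).

Definition cycle_rel (k : nat) : rel nat :=
  fun i j => [&& (i < k)%N, (j < k)%N &
                 (j == (i.+1 %% k)%N) || (i == (j.+1 %% k)%N)].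

(* Main.v *)
Require Import Defs.
From HB Require Import structures.
From mathcomp Require Import all_boot all_order all_algebra.
From mathcomp Require Import all_classical all_reals all_analysis.
From mathcomp Require Import measurable_realfun ring lra.

Set Implicit Arguments.
Unset Strict Implicit.
Unset Printing Implicit Defensive.

Import Order.TTheory GRing.Theory Num.Theory.
Import numFieldNormedType.Exports.
Local Open Scope ring_scope.

(* The vertices 0, ..., k-2 perform a walk on the sphere, each uniform on the great
   subsphere orthogonal to its predecessor, and only the last vertex contributes a
   nonconstant factor, (1 - <x_0,x_(k-2)>^2)^(-1/2).  For d >= 4 this factor, averaged
   over x_(k-2) alone, is bounded uniformly in x_(k-3): the subsphere has dimension at
   least 2, so a cap of radius r has measure O(r^2).  For d = 3 a cap of the circle has
   measure O(r).  Writing c = <x_0,x_(k-3)>, the quantity 1 - <x_0,x_(k-2)>^2 is at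
   least c^2 and at least the squared sine of the angle between x_(k-2) and the
   projection of x_0 to the plane of the circle, so averaging over x_(k-2) leaves
   O(|c|^(-1/2)); averaging over x_(k-3) then leaves
   O((1 - <x_0,x_(k-4)>^2)^(-1/4)), which is bounded for k = 5 (as x_1 is orthogonal
   to x_0) and after one more average for k >= 6; for k = 3 the factor is 1.
   The measure of caps is bounded using only the invariance of the uniform
   distribution: reflections carry a small cap to many disjoint caps. *)

(** * Integral bounds without measurability of the integrand *)

Section integral_bounds.
Local Open Scope ereal_scope.
Context d (T : measurableType d) (R : realType) (P : probability T R).
Import HBNNSimple.

(* The integral of a nonnegative function is a supremum over simple functions
   below it, so that monotonicity does not require measurability. *)
Lemma ge0_le_integral_nonmeas (F G : T -> \bar R) :
  (forall x, 0 <= F x) -> (forall x, F x <= G x) ->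
  \int[P]_(x in setT) F x <= \int[P]_(x in setT) G x.
Proof.
move=> F0 FG; have G0 x : 0 <= G x by apply: le_trans (FG x).
rewrite !ge0_integralTE //; apply: ereal_sup_le => _ [h /= hF <-].
by exists h => // x; apply: le_trans (FG x).
Qed.

(** Adding to [B] the function equal to [+oo] off [S] and 0 on [S] gives a measurable function that
    dominates [F] everywhere; the complement of [S] is null, so its integral is still that of
    [B]. *)
Lemma integral_le_of_full (S : set T) (F B : T -> \bar R) :
  measurable S -> P S = 1 -> (forall x, 0 <= F x) -> (forall x, 0 <= B x) ->
  measurable_fun setT B -> (forall x, S x -> F x <= B x) ->
  \int[P]_(x in setT) F x <= \int[P]_(x in setT) B x.
Proof.
move=> mS PS F0 B0 mB FB.
have mN := measurableC mS.
have N0 : P (~` S)%classic = 0 by rewrite probability_setC // PS subee.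
have Z0 x : 0 <= ((cst +oo : T -> \bar R) \_ (~` S)%classic) x.
  by rewrite patchE; case: ifP => _ /=; rewrite ?leey.
have mZ : measurable_fun setT ((cst +oo : T -> \bar R) \_ (~` S)%classic).
  by apply: (iffLR (measurable_restrictT _ mN)); exact: measurable_cst.
apply: (@le_trans _ _ (\int[P]_(x in setT)
  (B x + ((cst +oo : T -> \bar R) \_ (~` S)%classic) x))).
  apply: ge0_le_integral_nonmeas => // x; rewrite patchE.
  case: ifPn => [_|]; first by rewrite addey ?leey// gt_eqF// (lt_le_trans _ (B0 x)).
  by rewrite notin_setE /= adde0 => /contrapT /FB.
rewrite ge0_integralD // -(integral_mkcond (~` S)%classic).
have -> : \int[P]_(x in (~` S)%classic) (cst +oo : T -> \bar R) x = 0.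
  by rewrite integral_cst //= ?N0 ?mule0.
by rewrite adde0.
Qed.

Lemma integral_le_cst (S : set T) (F : T -> \bar R) (c : \bar R) :
  measurable S -> P S = 1 -> (forall x, 0 <= F x) -> 0 <= c ->
  (forall x, S x -> F x <= c) -> \int[P]_(x in setT) F x <= c.
Proof.
move=> mS PS F0 c0 Fc.
apply: (@le_trans _ _ (\int[P]_(x in setT) (cst c x))).
  by apply: (integral_le_of_full (B := cst c) mS PS) => //; exact: measurable_cst.
by rewrite integral_cst //= probability_setT mule1.
Qed.

End integral_bounds.

(** * The singular weight [q ^ (-1/4)] *)

(** All singular factors of the proof have this form: [q ^ (-1/2)] is the value at [q ^+ 2], and
    [|c| ^ (-1/2)] the value at [c ^+ 2]. The value [+oo] at 0 keeps the weight antitone and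
    positive. *)
Definition inv_root4 {R : realType} (q : R) : \bar R :=
  if q <= 0 then +oo%E else ((Num.sqrt (Num.sqrt q))^-1)%:E.

Section inv_root4_theory.
Context {R : realType}.
Implicit Types p q : R.

Lemma inv_root4_posE q : 0 < q ->
  inv_root4 q = ((Num.sqrt (Num.sqrt q))^-1)%:E.
Proof. by rewrite /inv_root4 ltNge => /negbTE ->. Qed.

Lemma inv_root4_gt0 q : (0 < inv_root4 q)%E.
Proof.
have [q0|q0] := leP q 0; first by rewrite /inv_root4 q0 lt0y.
by rewrite inv_root4_posE // lte_fin invr_gt0 !sqrtr_gt0.
Qed.

Lemma inv_root4_le p q : p <= q -> (inv_root4 q <= inv_root4 p)%E.
Proof.
move=> pq; have [p0|p0] := leP p 0; first by rewrite {2}/inv_root4 p0 leey.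
have q0 := lt_le_trans p0 pq; rewrite !inv_root4_posE // lee_fin.
by rewrite lef_pV2 ?posrE ?sqrtr_gt0 ?sqrtr_gt0 // !ler_wsqrtr.
Qed.

(** Multiplicativity survives at 0 because the weight is never 0, so that the product [+oo * 0] does
    not arise. *)
Lemma inv_root4M p q : 0 <= p -> 0 <= q ->
  inv_root4 (p * q) = (inv_root4 p * inv_root4 q)%E.
Proof.
have inv0 : inv_root4 (0 : R) = +oo%E by rewrite /inv_root4 lexx.
rewrite le0r => /orP[/eqP-> _|p0].
  by rewrite mul0r inv0 gt0_mulye // inv_root4_gt0.
rewrite le0r => /orP[/eqP->|q0].
  by rewrite mulr0 inv0 gt0_muley // inv_root4_gt0.
rewrite !inv_root4_posE ?mulr_gt0 // -EFinM.
by rewrite sqrtrM ?ltW // sqrtrM ?sqrtr_ge0 // invfM.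
Qed.

Lemma inv_root4_sqr q : 0 < q -> inv_root4 (q ^+ 2) = (Num.sqrt q)^-1%:E.
Proof. by move=> q0; rewrite inv_root4_posE ?exprn_gt0 // sqrtr_sqr gtr0_norm. Qed.

Lemma inv_root4_1 : inv_root4 (1 : R) = 1%E.
Proof. by rewrite inv_root4_posE // !sqrtr1 invr1. Qed.

Lemma inv_root4_le_of_gt (a q : R) : 0 < a -> (a ^+ 4)^-1 < q ->
  (inv_root4 q <= a%:E)%E.
Proof.
move=> a0 aq; have a4 : 0 < (a ^+ 4)^-1 by rewrite invr_gt0 exprn_gt0.
apply: le_trans (inv_root4_le (ltW aq)) _.
rewrite inv_root4_posE // (_ : (a ^+ 4)^-1 = ((a^-1) ^+ 2) ^+ 2); last first.
  by rewrite -!exprM exprVn.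
by rewrite !sqrtr_sqr normrX gtr0_norm ?invr_gt0 // sqrtr_sqr gtr0_norm ?invr_gt0 // invrK.
Qed.

End inv_root4_theory.

(** * Integrating the weight by dyadic layers *)

Section layers.
Local Open Scope ereal_scope.
Context d (T : measurableType d) (R : realType) (P : probability T R).

(** The weight at [q y] is at most [K] times 1 plus the sum of [2 ^ (n+1)] over the layers that
    contain [y]. The n-th layer contributes at most [2 ^ (n+1) / 4 ^ n = 2 / 2 ^ n] to the integral,
    and these sum to 4, whence the factor 5. *)
Lemma integral_inv_root4_le (S : set T) (q : T -> R) (K a : R) (F : T -> \bar R) :
  measurable S -> P S = 1 -> (0 < K)%R -> (0 <= a)%R ->
  (forall n, measurable [set y | (q y <= ((K * 2 ^+ n) ^+ 4)^-1)%R]%classic) ->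
  (forall n, P [set y | (q y <= ((K * 2 ^+ n) ^+ 4)^-1)%R]%classic <= ((4 ^+ n)^-1)%:E) ->
  (forall y, 0 <= F y) ->
  (forall y, S y -> F y <= a%:E * inv_root4 (q y)) ->
  \int[P]_(y in setT) F y <= (a * (K * 5))%:E.
Proof.
move=> mS PS K0 a0 mA PA F0 FS.
pose A (n : nat) : set T := [set y | (q y <= ((K * 2 ^+ n) ^+ 4)^-1)%R]%classic.
pose f (n : nat) (y : T) : \bar R := (2 ^+ n.+1)%:E * (\1_(A n) y)%:E.
have f0 n y : 0 <= f n y by rewrite /f mule_ge0 // lee_fin ?exprn_ge0 // indicE.
have mf n : measurable_fun setT (f n).
  apply: emeasurable_funM; first exact: measurable_cst.
  by apply/measurable_EFinP; apply: measurable_indic; exact: mA.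
have mfs : measurable_fun setT (fun y => \sum_(n <oo) f n y).
  have := @ge0_emeasurable_sum _ T R setT f xpredT.
  by apply=> *; [exact: f0|exact: mf].
have s0 y : 0 <= \sum_(n <oo) f n y by apply: nneseries_ge0.
have fs n y : f n y <= \sum_(n <oo) f n y.
  apply: le_trans (nneseries_lim_ge n.+1 _) => //.
  by rewrite big_nat_recr //= leeDr // sume_ge0.
have bound y : inv_root4 (q y) <= K%:E * (1 + \sum_(n <oo) f n y).
  have fA n : A n y -> f n y = (2 ^+ n.+1)%:E.
    by move=> An; rewrite /f indicE mem_set // mule1.
  (* If [y] lies in every layer, the series is infinite. Otherwise the first layer [A n] that misses
     [y] bounds the weight by [K * 2 ^ n], and for [n > 0] the layer [A n.-1] contains [y] and
     contributes exactly [2 ^ n]. *)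
  have [ex_n|all_n] := pselect (exists n, ~~ `[< A n y >]); last first.
    have An n : A n y.
      by apply: contrapT => h; apply: all_n; exists n; apply/asboolPn.
    suff -> : \sum_(n <oo) f n y = +oo.
      by rewrite addey // gt0_muley ?lte_fin // leey.
    apply: eq_infty => r; apply: le_trans (fs (Num.truncn r) y).
    rewrite fA // lee_fin; apply/ltW/(lt_le_trans (truncnS_gt r)).
    by rewrite -natrX ler_nat ltnW // ltn_expl.
  case: (ex_minnP ex_n) => n /asboolPn nAn minn.
  have Hn : inv_root4 (q y) <= (K * 2 ^+ n)%:E.
    by apply: inv_root4_le_of_gt; [rewrite mulr_gt0 // exprn_gt0|rewrite ltNge; apply/negP].
  apply: le_trans Hn _; rewrite EFinM; apply: lee_wpmul2l; first by rewrite lee_fin ltW.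
  case: n nAn minn => [_ _|n _ minn]; first by rewrite expr0 leeDl.
  rewrite -fA; first by apply: (le_trans (fs n y)); rewrite leeDr.
  by apply: contrapT => /asboolPn /minn; rewrite ltnn.
apply: (@le_trans _ _ (\int[P]_(y in setT) ((a * K)%:E * (1 + \sum_(n <oo) f n y)))).
  apply: (integral_le_of_full (B := fun y => (a * K)%:E * (1 + \sum_(n <oo) f n y)) mS PS) => //.
  - by move=> y; rewrite mule_ge0 ?adde_ge0 // lee_fin mulr_ge0 // ltW.
  - by apply: emeasurable_funM; [exact: measurable_cst|apply: emeasurable_funD].
  - move=> y /FS /le_trans; apply; rewrite EFinM -muleA.
    by apply: lee_pmul => //; apply: ltW; exact: inv_root4_gt0.
rewrite ge0_integralZl //; last 3 first.
- by apply: emeasurable_funD.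
- by move=> y _; rewrite adde_ge0.
- by rewrite lee_fin mulr_ge0 // ltW.
rewrite mulrA [leRHS]EFinM; apply: lee_wpmul2l; first by rewrite lee_fin mulr_ge0 // ltW.
rewrite ge0_integralD // integral_cst //= probability_setT mule1.
rewrite integral_nneseries //.
have -> : 5%:E = 1 + 4%:E :> \bar R by rewrite -EFinD; congr (_%:E); ring.
apply: leeD => //.
apply: lime_le; first by apply: is_cvg_nneseries => n _ _; exact: integral_ge0.
apply: nearW => N.
apply: (@le_trans _ _ (\sum_(0 <= n < N) (2 / 2 ^+ n)%:E)).
  apply: lee_sum => n _.
  rewrite ge0_integralZl //; last first.
  - by apply/measurable_EFinP; apply: measurable_indic; exact: mA.
  rewrite integral_indic //= ?setIT; last exact: mA.
  apply: (@le_trans _ _ ((2 ^+ n.+1)%:E * ((4 ^+ n)^-1)%:E)).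
    apply: lee_wpmul2l; first by rewrite lee_fin exprn_ge0.
    by rewrite ?setIT; exact: PA.
  rewrite -EFinM lee_fin (_ : 4 = 2 * 2)%R ?exprMn ?exprS; last by ring.
  by rewrite invfM mulrA mulfK // expf_neq0.
rewrite sumEFin lee_fin.
suff -> : (\sum_(0 <= n < N) 2 / 2 ^+ n = 4 - 4 / 2 ^+ N :> R)%R.
  by rewrite gerBl divr_ge0 // exprn_ge0.
elim: N => [|N IH]; first by rewrite big_nil expr0 divr1 subrr.
rewrite big_nat_recr //= IH exprS; have : (2 ^+ N != 0 :> R)%R by rewrite expf_neq0.
by move=> ?; field.
Qed.

End layers.

(** * Euclidean geometry: orthogonal vectors, reflections, caps *)

Section dotv_theory.
Context {R : realType} {d : nat}.
Implicit Types (x y z e f u w : 'rV[R]_d) (a : R).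

Lemma dotvE x y : dotv x y = \sum_i x 0 i * y 0 i.
Proof. by rewrite /dotv mxE; apply: eq_bigr => i _; rewrite mxE. Qed.

Lemma dotvC x y : dotv x y = dotv y x.
Proof. by rewrite !dotvE; apply: eq_bigr => i _; rewrite mulrC. Qed.

Lemma dotvDl x y z : dotv (x + y) z = dotv x z + dotv y z.
Proof. by rewrite /dotv mulmxDl mxE. Qed.

Lemma dotvZl a x y : dotv (a *: x) y = a * dotv x y.
Proof. by rewrite /dotv -scalemxAl mxE. Qed.

Lemma dotvNl x y : dotv (- x) y = - dotv x y.
Proof. by rewrite -scaleN1r dotvZl mulN1r. Qed.

Lemma dotvDr x y z : dotv x (y + z) = dotv x y + dotv x z.
Proof. by rewrite dotvC dotvDl ![dotv _ x]dotvC. Qed.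

Lemma dotvZr a x y : dotv x (a *: y) = a * dotv x y.
Proof. by rewrite dotvC dotvZl dotvC. Qed.

Lemma dotvNr x y : dotv x (- y) = - dotv x y.
Proof. by rewrite dotvC dotvNl dotvC. Qed.

Definition dotv_linE := (dotvDl, dotvNl, dotvZl, dotvDr, dotvNr, dotvZr).

Lemma dotv_ge0 x : 0 <= dotv x x.
Proof. by rewrite dotvE sumr_ge0 // => i _; rewrite -expr2 sqr_ge0. Qed.

Lemma dotv_eq0 x : (dotv x x == 0) = (x == 0).
Proof.
apply/eqP/eqP => [|->]; last first.
  by rewrite dotvE big1 // => i _; rewrite mxE mul0r.
rewrite dotvE => /eqP; rewrite psumr_eq0; last by move=> i _; rewrite -expr2 sqr_ge0.
move=> /allP x0; apply/rowP => i; rewrite mxE.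
have := x0 i (mem_index_enum _).
by rewrite -expr2 sqrf_eq0 => /eqP.
Qed.

Lemma dotv_gt0 x : x != 0 -> 0 < dotv x x.
Proof. by move=> x0; rewrite lt0r dotv_eq0 x0 dotv_ge0. Qed.

Definition normalize x : 'rV[R]_d := (Num.sqrt (dotv x x))^-1 *: x.

Lemma normalize_unit x : x != 0 -> dotv (normalize x) (normalize x) = 1.
Proof.
move=> /dotv_gt0 x0; rewrite /normalize !dotv_linE.
by rewrite mulrA -invfM -expr2 sqr_sqrtr ?ltW // mulVf // gt_eqF.
Qed.

Lemma normalizeK x : x != 0 -> Num.sqrt (dotv x x) *: normalize x = x.
Proof.
by move=> /dotv_gt0 x0; rewrite /normalize scalerA mulfV ?scale1r // gt_eqF // sqrtr_gt0.
Qed.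

Lemma dotv_sqr_le1 x y : dotv x x = 1 -> dotv y y = 1 -> dotv x y ^+ 2 <= 1.
Proof.
move=> x1 y1; have := dotv_ge0 (x - dotv x y *: y).
rewrite !dotv_linE x1 y1 (dotvC y x) expr2; lra.
Qed.

(** The matrix with columns [ys] has rank below [d], so its left kernel contains a nonzero row,
    which is then normalized. *)
Lemma exists_unit_orth (ys : seq 'rV[R]_d) : (size ys < d)%N ->
  exists v : 'rV[R]_d, dotv v v = 1 /\ (forall y, y \in ys -> dotv v y = 0).
Proof.
move=> sd; pose M : 'M[R]_(d, size ys) := \matrix_(i, j) ys`_j 0 i.
have kM : kermx M != 0.
  rewrite -mxrank_eq0 mxrank_ker subn_eq0 -ltnNge.
  exact: leq_ltn_trans (rank_leq_col M) sd.
pose v := nz_row (kermx M).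
have v0 : v != 0 by rewrite nz_row_eq0.
have vM : v *m M = 0 by apply/sub_kermxP; exact: nz_row_sub.
exists (normalize v); split; first exact: normalize_unit.
move=> y yys; rewrite /normalize dotvZl.
suff -> : dotv v y = 0 by rewrite mulr0.
have iy : (index y ys < size ys)%N by rewrite index_mem.
have /rowP/(_ (Ordinal iy)) := vM; rewrite !mxE dotvE => {2}<-.
by apply: eq_bigr => i _; rewrite mxE /= nth_index.
Qed.

Lemma orth_decomposition u w : (1 < d)%N -> dotv w w = 1 ->
  exists e (s : R), [/\ dotv e e = 1, dotv e w = 0 & u = dotv u w *: w + s *: e].
Proof.
move=> d1 w1; pose p := u - dotv u w *: w.
have pw : dotv p w = 0 by rewrite /p !dotv_linE w1 mulr1 subrr.
have up : u = dotv u w *: w + p by rewrite /p addrC subrK.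
(* If [u] is parallel to [w], any unit vector orthogonal to [w] serves, with [s = 0]; [1 < d]
   provides one. *)
have [p0|p0] := eqVneq p 0.
  have [e [e1 ew]] := @exists_unit_orth [:: w] d1.
  exists e, 0; split => //; first by apply: ew; rewrite mem_head.
  by rewrite scale0r -p0.
exists (normalize p), (Num.sqrt (dotv p p)); rewrite normalize_unit // normalizeK //.
by split => //; rewrite /normalize dotvZl pw mulr0.
Qed.

Lemma reflection_involutive (n : 'rV[R]_d) a : a * dotv n n = 2 ->
  let Q := 1%:M - a *: (n^T *m n) in Q *m Q = 1%:M.
Proof.
move=> an; set N := n^T *m n.
have NN : N *m N = dotv n n *: N.
  rewrite /N mulmxA -(mulmxA n^T n) [n *m n^T]mx11_scalar.
  by rewrite mul_mx_scalar -scalemxAl.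
rewrite /= mulmxBl mul1mx mulmxBr mulmx1 -scalemxAl -scalemxAr NN !scalerA.
by rewrite -mulrA an mulr_natr mulr2n scalerDl opprB addrK subrK.
Qed.

(** The reflection in the hyperplane orthogonal to [e - f] exchanges [e] and [f]. For [e = f] there
    is no such hyperplane and the identity is taken. *)
Lemma householder e f : dotv e e = 1 -> dotv f f = 1 ->
  exists Q : 'M[R]_d, [/\ Q *m Q^T = 1%:M,
    forall y, dotv y e = 0 -> dotv y f = 0 -> y *m Q = y &
    forall y, dotv (y *m Q) f = dotv y e].
Proof.
move=> e1 f1; have [<-|ef] := eqVneq e f.
  by exists 1%:M; split => [|y _ _|y]; rewrite ?trmx1 ?mulmx1.
pose n := e - f; pose a := 2 / dotv n n.
have nn0 : dotv n n != 0 by rewrite dotv_eq0 subr_eq0.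
have an : a * dotv n n = 2 by rewrite /a divfK.
pose Q : 'M[R]_d := 1%:M - a *: (n^T *m n).
have yQ y : y *m Q = y - (a * dotv y n) *: n.
  rewrite /Q mulmxBr mulmx1 -scalemxAr mulmxA [y *m n^T]mx11_scalar.
  by rewrite mul_scalar_mx scalerA.
have QT : Q^T = Q.
  by rewrite /Q raddfB /= trmx1 linearZ /= trmx_mul trmxK.
exists Q; split.
- by rewrite QT; exact: reflection_involutive.
- by move=> y ye yf; rewrite yQ /n !dotv_linE ye yf subrr mulr0 scale0r subr0.
move=> y; rewrite yQ; move: an; rewrite /n !dotv_linE e1 f1 (dotvC f e).
move: (dotv y e) (dotv y f) (dotv e f) => p q c an.
(* The factor [1 - c + - (c - 1)] is the squared norm of [e - f], so that [an] turns its product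
   with [a] into 2. *)
have -> : q + - (a * (p - q) * (c + - 1)) =
  q + (p - q) * (a * (1 - c + - (c - 1)) / 2) by field.
by rewrite an divff ?pnatr_eq0 //; ring.
Qed.

(** Used to separate caps. The components of [e] and [f] orthogonal to [y] have squared norm at most
    [t] and inner product [c - a * b], so [|c - a * b| <= t]. As [|a * b| >= 1 - t], this gives
    [|c| >= 1 - 2 * t], hence [c ^+ 2 >= 1 - 4 * t]. *)
Lemma cap_disjoint e f y (t : R) : dotv e e = 1 -> dotv f f = 1 -> dotv y y = 1 ->
  t <= 2^-1 -> 1 - dotv e y ^+ 2 <= t -> 1 - dotv f y ^+ 2 <= t ->
  1 - dotv e f ^+ 2 <= 4 * t.
Proof.
move=> e1 f1 y1 t2 et ft.
have := dotv_ge0 ((e - dotv e y *: y) + (f - dotv f y *: y)).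
have := dotv_ge0 ((e - dotv e y *: y) - (f - dotv f y *: y)).
rewrite !dotv_linE e1 f1 y1 (dotvC y e) (dotvC y f) (dotvC f e).
move: et ft; set a := dotv e y; set b := dotv f y; set c := dotv e f => et ft h1 h2.
have t0 : 0 <= t by apply: le_trans et; rewrite subr_ge0 dotv_sqr_le1.
have h3 : - t <= c - a * b <= t by move: et ft h1 h2; rewrite !expr2; nra.
have ab2 : (1 - t) ^+ 2 <= (a * b) ^+ 2.
  by rewrite exprMn expr2; apply: ler_pM; lra.
have ab1 : 1 - t <= `|a * b| by rewrite -(@ler_pXn2r _ 2) ?nnegrE ?real_normK ?num_real //; lra.
have c1 : 1 - 2 * t <= `|c|.
  have : `|a * b| <= `|c| + `|c - a * b|.
    by rewrite -{1}(subrK c (a * b)) addrC (le_trans (ler_normD _ _)) // distrC.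
  have : `|c - a * b| <= t by rewrite ler_norml.
  by lra.
have c2 : (1 - 2 * t) ^+ 2 <= c ^+ 2.
  by rewrite -[c ^+ 2]real_normK ?num_real // ler_pXn2r ?nnegrE //; lra.
by have := sqr_ge0 t; move: c2; rewrite !expr2; nra.
Qed.

End dotv_theory.

Lemma natr_sub_sqr_ge1 (R : realType) (i j : nat) : i != j ->
  1 <= (i%:R - j%:R) ^+ 2 :> R.
Proof.
wlog ij : i j / (i < j)%N.
  by move=> h; rewrite neq_ltn => /orP[] ij; [|rewrite -sqrrN opprB]; apply: h; rewrite // ltn_eqF.
move=> _; rewrite -sqrrN opprB -natrB 1?ltnW // exprn_ege1 // ler1n subn_gt0 //.
Qed.

(** * Measure of caps by packing *)

Section uniform_measure.
Context {R : realType} {d : nat}.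
Implicit Types (e w : 'rV[R]_d) (ys : seq 'rV[R]_d) (mu : probability (Rd R d) R).

Lemma closed_measurable_Rd (A : set 'rV[R]_d) : closed A ->
  measurable (A : set (Rd R d)).
Proof.
move=> cA; rewrite -[X in measurable X]setCK; apply: measurableC.
by apply: sub_sigma_algebra; exact: closed_openC.
Qed.

Lemma continuous_measurable_le (q : 'rV[R]_d -> R) (t : R) : continuous q ->
  measurable ([set y | q y <= t]%classic : set (Rd R d)).
Proof.
move=> /continuous_closedP cq.
exact: closed_measurable_Rd (cq _ (@closed_le _ t)).
Qed.

Lemma dotv_continuous (f g : 'rV[R]_d -> 'rV[R]_d) :
  continuous f -> continuous g -> continuous (fun y => dotv (f y) (g y)).
Proof.
move=> cf cg; rewrite (_ : (fun y => _) = (fun y => \sum_i f y 0 i * g y 0 i)); last first.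
  by apply/funext => y; rewrite dotvE.
apply: continuous_big => [|i _].
  by move=> x; exact: add_continuous.
have ci (h : 'rV[R]_d -> 'rV[R]_d) : continuous h -> continuous (fun y => h y 0 i).
  move=> ch y.
  by apply: (@continuous_comp _ _ _ h (fun M => M 0 i)); [exact: ch|exact: coord_continuous].
by move=> y; exact: cvgM (ci _ cf y) (ci _ cg y).
Qed.

Lemma cap_continuous e : continuous (fun y : 'rV[R]_d => 1 - dotv e y ^+ 2).
Proof.
have ce : continuous (fun y : 'rV[R]_d => dotv e y).
  by apply: (@dotv_continuous (fun=> e) id) => y; [exact: cst_continuous|exact: cvg_id].
move=> y; exact: (cvgB (@cst_continuous _ _ (1 : R) y) (cvgM (ce y) (ce y))).
Qed.

Lemma orth_sphere_measurable ys : measurable (orth_sphere ys).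
Proof.
have cl (f : 'rV[R]_d -> R) (c : R) : continuous f -> closed [set x | f x = c]%classic.
  by move=> /continuous_closedP cf; exact: (cf _ (@closed_eq _ c)).
have -> : orth_sphere ys = ([set x : 'rV[R]_d | dotv x x = 1] `&`
    \bigcap_(y in [set` ys]) [set x : 'rV[R]_d | dotv x y = 0])%classic.
  by apply/seteqP; split => x [].
apply: closed_measurable_Rd; apply: closedI.
  by apply: cl; apply: (@dotv_continuous id id) => y; exact: cvg_id.
apply: closed_bigI => y _; apply: cl.
by apply: (@dotv_continuous id (fun=> y)) => z; [exact: cvg_id|exact: cst_continuous].
Qed.

Lemma unit_cap_measurable e (t : R) :
  measurable ([set y | dotv y y = 1 /\ 1 - dotv e y ^+ 2 <= t]%classic : set (Rd R d)).
Proof.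
rewrite (_ : mkset _ = (orth_sphere [::] `&` [set y | 1 - dotv e y ^+ 2 <= t])%classic).
  apply: measurableI; first exact: orth_sphere_measurable.
  exact: continuous_measurable_le _ (@cap_continuous e).
by apply/seteqP; split => y /= [h ?]; split => //; case: h.
Qed.

(* Reflections fixing [w] carry the cap around [e] to [N] pairwise disjoint caps
   of the same measure. *)
Lemma cap_measure_le mu w e (N : nat) (f : 'I_N -> 'rV[R]_d) (t : R) :
  uniform_on_orth_sphere [:: w] mu -> t <= 2^-1 ->
  dotv e e = 1 -> dotv e w = 0 ->
  (forall i, dotv (f i) (f i) = 1) -> (forall i, dotv (f i) w = 0) ->
  (forall i j, i != j -> 4 * t < 1 - dotv (f i) (f j) ^+ 2) ->
  (N%:R%:E * mu [set y | (1 - dotv e y ^+ 2 <= t)%R]%classic <= 1)%E.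
Proof.
move=> [muS muQ] t2 e1 ew f1 fw sep.
(* [cap_disjoint] requires unit vectors, so the caps are cut down to the sphere; what is lost is
   null for [mu]. *)
pose A u : set (Rd R d) := [set y | dotv y y = 1 /\ 1 - dotv u y ^+ 2 <= t]%classic.
have mA u : measurable (A u) by exact: unit_cap_measurable.
have AE i : mu (A (f i)) = mu (A e).
  have [Q [QQ Qfix Qf]] := householder e1 (f1 i).
  rewrite -(muQ Q QQ _ _ (mA (f i))); last first.
    by move=> y; rewrite inE => /eqP ->; apply: Qfix; rewrite dotvC.
  congr (mu _); apply/seteqP.
  have nQ y : dotv (y *m Q) (y *m Q) = dotv y y.
    by rewrite /dotv trmx_mul mulmxA -(mulmxA y) QQ mulmx1.
  by split => y /=; rewrite inE /A /= nQ (dotvC (f i)) Qf (dotvC e).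
have mle : (mu [set y | (1 - dotv e y ^+ 2 <= t)%R]%classic <= mu (A e))%E.
  have mS := orth_sphere_measurable [:: w].
  have mN := measurableC mS.
  have N0 : mu (~` (orth_sphere [:: w]))%classic = 0%E by rewrite probability_setC // muS subee.
  apply: (@le_trans _ _ (mu (A e `|` ~` (orth_sphere [:: w]))%classic)).
    apply: le_measure; rewrite ?inE.
    - exact: continuous_measurable_le _ (@cap_continuous e).
    - exact: measurableU.
    move=> y /= yt; have [[y1 _]|] := pselect (orth_sphere [:: w] y); last by right.
    by left.
  apply: (le_trans (measureU2 _ _ _)) => //.
  by rewrite /= N0 adde0.
apply: (@le_trans _ _ (\sum_(i < N) mu (A (f i)))%E).
  apply: (le_trans (lee_wpmul2l _ mle)); first by rewrite lee_fin.
  have fA : mu (A e) \is a fin_num by exact: fin_num_measure.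
  rewrite (eq_bigr (fun=> (fine (mu (A e)))%:E)) => [|i _]; last by rewrite AE /= fineK.
  by rewrite sumEFin sumr_const card_ord -(mulr_natl (fine _)) EFinM fineK.
rewrite -measure_bigsetU_ord //; last first.
  apply/trivIsetP => i j _ _ ij; apply/disjoints_subset => y [y1 yi] [_ yj].
  by have := cap_disjoint (f1 i) (f1 j) y1 t2 yi yj; rewrite leNgt sep.
apply: probability_le1; apply: bigsetU_measurable => i _; exact: mA.
Qed.

(** The cap centres are the normalized [v i], indexed by points [(s i, r i)] of the unit square. By
    Lagrange's identity the Gram determinant of [v i] and [v j] is the squared distance of their
    points plus [(s i * r j - s j * r i) ^+ 2], hence at least [eta]. The squared norms are at most
    3, so the squared sine of the angle is at least [eta / 9], which exceeds [4 * t]: this is the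
    origin of 36. *)
Lemma packing_measure_le mu w e (N : nat) (v : 'I_N -> 'rV[R]_d) (s r : 'I_N -> R)
    (eta t : R) :
  uniform_on_orth_sphere [:: w] mu -> t <= 2^-1 -> 0 <= t -> 36 * t < eta ->
  dotv e e = 1 -> dotv e w = 0 -> (0 < N)%N ->
  (forall i, dotv (v i) w = 0) ->
  (forall i j, dotv (v i) (v j) = 1 + s i * s j + r i * r j) ->
  (forall i, 0 <= s i <= 1) -> (forall i, 0 <= r i <= 1) ->
  (forall i j, i != j -> eta <= (s i - s j) ^+ 2 + (r i - r j) ^+ 2) ->
  (mu [set y | (1 - dotv e y ^+ 2 <= t)%R]%classic <= (N%:R^-1)%:E)%E.
Proof.
move=> unif t2 t0 teta e1 ew N0 vw vv s01 r01 sep.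
have v3 i : 1 <= dotv (v i) (v i) <= 3.
  by rewrite vv; have := s01 i; have := r01 i; nra.
have vn0 i : v i != 0.
  by rewrite -dotv_eq0 gt_eqF //; have := v3 i; lra.
have H : (N%:R%:E * mu [set y | (1 - dotv e y ^+ 2 <= t)%R]%classic <= 1)%E.
  apply: (@cap_measure_le mu w e N (fun i => normalize (v i))) => // [i|i|i j ij].
  - exact: normalize_unit.
  - by rewrite /normalize dotvZl vw mulr0.
  set a := dotv (v i) (v i); set b := dotv (v j) (v j); set c := dotv (v i) (v j).
  have /andP[a1 a3] : 1 <= a <= 3 by exact: v3.
  have /andP[b1 b3] : 1 <= b <= 3 by exact: v3.
  have -> : dotv (normalize (v i)) (normalize (v j)) ^+ 2 = c ^+ 2 / (a * b).
    rewrite /normalize !dotv_linE !exprMn -/c !exprVn !sqr_sqrtr ?dotv_ge0 //.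
    by rewrite -/a -/b invfM; ring.
  have ab0 : 0 < a * b by rewrite mulr_gt0 //; lra.
  have -> : 1 - c ^+ 2 / (a * b) = (a * b - c ^+ 2) / (a * b).
    by rewrite mulrBl divff // gt_eqF.
  rewrite ltr_pdivlMr //.
  have : eta <= a * b - c ^+ 2.
    rewrite /a /b /c !vv; apply: le_trans (sep i j ij) _.
    have := sqr_ge0 (s i * r j - s j * r i); rewrite !expr2; lra.
  have : 0 <= t * (9 - a * b) by rewrite mulr_ge0 // subr_ge0; nra.
  by lra.
move: H; set m := mu _.
have : m \is a fin_num by apply: fin_num_measure; exact: continuous_measurable_le _ (@cap_continuous e).
move=> /fineK <-; rewrite -EFinM !lee_fin => H.
by rewrite -(ler_pM2l (_ : 0 < N%:R)) ?ltr0n // mulfV // pnatr_eq0 -lt0n.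
Qed.

Lemma cap_integral_le mu w (K a : R) (q : 'rV[R]_d -> R) (F : Rd R d -> \bar R) :
  uniform_on_orth_sphere [:: w] mu -> continuous q -> 0 < K -> 0 <= a ->
  (forall n, mu [set y | (q y <= ((K * 2 ^+ n) ^+ 4)^-1)%R]%classic <= ((4 ^+ n)^-1)%:E)%E ->
  (forall y, 0 <= F y)%E ->
  (forall y, orth_sphere [:: w] y -> F y <= a%:E * inv_root4 (q y))%E ->
  (\int[mu]_(y in setT) F y <= (a * (K * 5))%:E)%E.
Proof.
move=> [muS _] cq K0 a0 qmu F0 Fq.
apply: (integral_inv_root4_le (orth_sphere_measurable [:: w]) muS K0 a0 _ qmu) => // n.
exact: continuous_measurable_le.
Qed.

(** The [m = 4 ^ n] centres lie in the directions [e + (i / m) *: f], with spacing [1 / m]. The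
    threshold is [7 ^ (-4) / m ^ 2], and [36 < 7 ^ 4]. *)
Lemma circle_cap_le mu w e (n : nat) : (2 < d)%N ->
  uniform_on_orth_sphere [:: w] mu -> dotv e e = 1 -> dotv e w = 0 ->
  (mu [set y | (1 - dotv e y ^+ 2 <= ((7 * 2 ^+ n) ^+ 4)^-1)%R]%classic
    <= ((4 ^+ n)^-1)%:E)%E.
Proof.
move=> d2 unif e1 ew.
have [f [f1 fo]] := @exists_unit_orth R d [:: w; e] d2.
have fw : dotv f w = 0 by apply: fo; rewrite !inE eqxx.
have fe : dotv f e = 0 by apply: fo; rewrite !inE eqxx orbT.
have [m mE] : exists m, m = (4 ^ n)%N by exists (4 ^ n)%N.
have m0 : (0 < m)%N by rewrite mE expn_gt0.
have mR : 0 < m%:R :> R by rewrite ltr0n.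
have m1 : 0 <= (m%:R^-1 : R) <= 1 by rewrite invr_ge0 ler0n invf_le1 // ler1n.
have m2 : 0 <= (m%:R^-1 : R) ^+ 2 <= 1 by rewrite sqr_ge0 exprn_ile1 //; case/andP: m1.
have m20 : 0 < (m%:R^-1) ^+ 2 :> R by rewrite exprn_gt0 // invr_gt0.
have -> : 4 ^+ n = m%:R :> R by rewrite mE natrX.
have : ((7 * 2 ^+ n) ^+ 4)^-1 = 2401^-1 * (m%:R^-1) ^+ 2 :> R.
  have x0 : 2 ^+ n != 0 :> R by rewrite expf_neq0.
  have -> : m%:R = (2 ^+ n) ^+ 2 :> R.
    by rewrite mE -exprM mulnC exprM natrX; congr (_ ^+ n); ring.
  by field.
move: (((7 * 2 ^+ n) ^+ 4)^-1 : R) => t tE.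
have [t0 t2 t36] : [/\ 0 <= t, t <= 2^-1 & 36 * t < (m%:R^-1) ^+ 2].
  rewrite tE; split; lra.
apply: (@packing_measure_le mu w e m (fun i => e + (i%:R / m%:R) *: f)
  (fun i => i%:R / m%:R) (fun=> 0) ((m%:R^-1) ^+ 2)) => //.
- by move=> i; rewrite !dotv_linE ew fw mulr0 addr0.
- by move=> i j; rewrite !dotv_linE e1 f1 (dotvC e f) fe; ring.
- move=> i; rewrite divr_ge0 ?ler0n //= ler_pdivrMr // mul1r ler_nat ltnW //.
- by move=> i; rewrite lexx ler01.
move=> i j ij; rewrite subrr expr0n addr0 -mulrBl exprMn ler_peMl //.
exact: natr_sub_sqr_ge1.
Qed.

(** A second direction [g] permits an [m] by [m] grid with [m = 2 ^ n], so [4 ^ n] caps fit at the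
    coarser spacing [2 ^ (-n)]. The threshold, after a square root, is [7 ^ (-2) / m ^ 2]; 7 is the
    least integer whose square exceeds 36. *)
Lemma sphere_cap_le mu w e (n : nat) : (3 < d)%N ->
  uniform_on_orth_sphere [:: w] mu -> dotv e e = 1 -> dotv e w = 0 ->
  (mu [set y | (((1 - dotv e y ^+ 2) ^+ 2) <= ((7 * 2 ^+ n) ^+ 4)^-1)%R]%classic
    <= ((4 ^+ n)^-1)%:E)%E.
Proof.
move=> d3 unif e1 ew.
have [f [f1 fo]] := @exists_unit_orth R d [:: w; e] (ltnW d3).
have fw : dotv f w = 0 by apply: fo; rewrite !inE eqxx.
have fe : dotv f e = 0 by apply: fo; rewrite !inE eqxx orbT.
have [g [g1 go]] := @exists_unit_orth R d [:: w; e; f] d3.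
have gw : dotv g w = 0 by apply: go; rewrite !inE eqxx.
have ge : dotv g e = 0 by apply: go; rewrite !inE eqxx orbT.
have gf : dotv g f = 0 by apply: go; rewrite !inE eqxx !orbT.
have [m mE] : exists m, m = (2 ^ n)%N by exists (2 ^ n)%N.
have m0 : (0 < m)%N by rewrite mE expn_gt0.
have mR : 0 < m%:R :> R by rewrite ltr0n.
have m1 : 0 <= (m%:R^-1 : R) <= 1 by rewrite invr_ge0 ler0n invf_le1 // ler1n.
have m2 : 0 <= (m%:R^-1 : R) ^+ 2 <= 1 by rewrite sqr_ge0 exprn_ile1 //; case/andP: m1.
have m20 : 0 < (m%:R^-1) ^+ 2 :> R by rewrite exprn_gt0 // invr_gt0.
have [t [tE t0 t2 t36]] : exists t : R, [/\ ((7 * 2 ^+ n) ^+ 4)^-1 = t ^+ 2,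
    0 <= t, t <= 2^-1 & 36 * t < (m%:R^-1) ^+ 2].
  exists (49^-1 * (m%:R^-1) ^+ 2); split; [|lra|lra|lra].
  by rewrite mE natrX; field; rewrite expf_neq0.
apply: (@le_trans _ _ (mu [set y | (1 - dotv e y ^+ 2 <= t)%R]%classic)).
  apply: le_measure; rewrite ?inE.
  - apply: (continuous_measurable_le _ (q := fun y => (1 - dotv e y ^+ 2) ^+ 2)).
    by move=> y; exact: (cvgM (@cap_continuous e y) (@cap_continuous e y)).
  - exact: continuous_measurable_le _ (@cap_continuous e).
  move=> y /=; rewrite tE => h; rewrite leNgt; apply/negP => h'.
  by move: h; rewrite leNgt ltr_pXn2r ?nnegrE ?h' // ltW // (le_lt_trans t0).
have -> : 4 ^+ n = (m * m)%:R :> R by rewrite mE -expnMn natrX.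
(* Quotient and remainder by [m] are the two grid coordinates of [i]. *)
pose s (i : 'I_(m * m)) : R := (i %/ m)%N%:R / m%:R.
pose r (i : 'I_(m * m)) : R := (i %% m)%N%:R / m%:R.
apply: (@packing_measure_le mu w e (m * m) (fun i => e + s i *: f + r i *: g)
  s r ((m%:R^-1) ^+ 2)) => //.
- by rewrite muln_gt0 m0.
- by move=> i; rewrite !dotv_linE ew fw gw !mulr0 !addr0.
- move=> i j; rewrite !dotv_linE e1 f1 g1 (dotvC e f) (dotvC e g) (dotvC f g).
  by rewrite fe ge gf; ring.
- move=> i; rewrite divr_ge0 ?ler0n //= ler_pdivrMr // mul1r ler_nat.
  by rewrite ltnW // ltn_divLR.
- move=> i; rewrite divr_ge0 ?ler0n //= ler_pdivrMr // mul1r ler_nat.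
  by rewrite ltnW // ltn_mod.
move=> i j ij; rewrite /s /r -!mulrBl !exprMn -mulrDl ler_peMl //.
have [eqd|ned] := eqVneq (i %/ m)%N (j %/ m)%N; last first.
  by apply: le_trans (natr_sub_sqr_ge1 R ned) _; rewrite lerDl sqr_ge0.
have nem : (i %% m)%N != (j %% m)%N.
  apply: contra_neq ij => eqm; apply/val_inj.
  by rewrite /= (divn_eq i m) eqd eqm -divn_eq.
by apply: le_trans (natr_sub_sqr_ge1 R nem) _; rewrite lerDr sqr_ge0.
Qed.

End uniform_measure.

(** * One-step averages of the singular weights *)

Section singular_integrals.
Context {R : realType} {d : nat}.
Implicit Types (e u w : 'rV[R]_d) (mu : probability (Rd R d) R).

Lemma orth_sphere1P w (y : Rd R d) : orth_sphere [:: w] y -> dotv y y = 1 /\ dotv y w = 0.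
Proof. by move=> [y1 yw]; split => //; apply: yw; rewrite mem_head. Qed.

(** The factor [h] holds the part of a singularity that does not depend on [y]; it may be [+oo], and
    then the bound is trivial. The constant 35 is [K * 5] for [K = 7]. *)
Lemma circle_integral_le mu w e (a : R) (h : \bar R) (F : Rd R d -> \bar R) :
  (2 < d)%N -> uniform_on_orth_sphere [:: w] mu -> dotv e e = 1 -> dotv e w = 0 ->
  0 < a -> (0 < h)%E -> (forall y, 0 <= F y)%E ->
  (forall y, orth_sphere [:: w] y -> F y <= a%:E * h * inv_root4 (1 - dotv e y ^+ 2))%E ->
  (\int[mu]_(y in setT) F y <= (a * 35)%:E * h)%E.
Proof.
move=> d2 unif e1 ew a0 h0 F0 Fh.
have -> : (35 = 7 * 5 :> R) by ring.
case: h h0 Fh => [r r0 Fh|_ _|//]; last first.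
  by rewrite gt0_muley ?leey // lte_fin; lra.
rewrite -EFinM mulrAC; rewrite lte_fin in r0.
apply: (cap_integral_le unif (@cap_continuous R d e)) => //.
- by rewrite mulr_ge0 // ltW.
- by move=> n; exact: circle_cap_le unif e1 ew.
Qed.

(** For [y] orthogonal to [w], [dotv u y = s * dotv e y] with [s ^+ 2 <= 1]. Replacing [u] by [e],
    which lies in the subsphere, can therefore only increase the weight. *)
Lemma singular_integral_le_sphere mu w u (a : R) (F : Rd R d -> \bar R) :
  (3 < d)%N -> uniform_on_orth_sphere [:: w] mu -> dotv w w = 1 -> dotv u u = 1 ->
  0 < a -> (forall y, 0 <= F y)%E ->
  (forall y, orth_sphere [:: w] y ->
     F y <= a%:E * inv_root4 ((1 - dotv u y ^+ 2) ^+ 2))%E ->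
  (\int[mu]_(y in setT) F y <= (a * 35)%:E)%E.
Proof.
move=> d3 unif w1 u1 a0 F0 Fu.
have [e [s [e1 ew uE]]] := orth_decomposition u (ltn_trans (isT : 1 < 3)%N d3) w1.
have -> : (35 = 7 * 5 :> R) by ring.
have s1 : s ^+ 2 <= 1.
  have := u1; rewrite {1 2}uE !dotv_linE w1 e1 ew (dotvC w e) ew => h.
  by have := sqr_ge0 (dotv u w); rewrite !expr2; lra.
apply: (cap_integral_le (q := fun y => (1 - dotv e y ^+ 2) ^+ 2) unif) => //.
- by move=> y; exact: (cvgM (@cap_continuous _ _ e y) (@cap_continuous _ _ e y)).
- exact: ltW.
- by move=> n; exact: sphere_cap_le unif e1 ew.
move=> y yS; have [y1 yw] := orth_sphere1P yS.
apply: (le_trans (Fu y yS)); apply: lee_wpmul2l; first by rewrite lee_fin ltW.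
apply: inv_root4_le.
have ey := dotv_sqr_le1 e1 y1.
have -> : dotv u y = s * dotv e y by rewrite uE !dotv_linE (dotvC w) yw mulr0 add0r.
have h : s ^+ 2 * dotv e y ^+ 2 <= dotv e y ^+ 2 by rewrite ler_piMl // sqr_ge0.
by rewrite exprMn ler_pXn2r ?nnegrE //; lra.
Qed.

(* If [e] is the normalized projection of [u] orthogonally to [w], both
   [dotv u w ^+ 2] and [1 - dotv e y ^+ 2] are at most [1 - dotv u y ^+ 2], whose
   square thus dominates their product. *)
Lemma singular_integral_le_circle mu w u (a : R) (F : Rd R d -> \bar R) :
  (2 < d)%N -> uniform_on_orth_sphere [:: w] mu -> dotv w w = 1 -> dotv u u = 1 ->
  0 < a -> (forall y, 0 <= F y)%E ->
  (forall y, orth_sphere [:: w] y ->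
     F y <= a%:E * inv_root4 ((1 - dotv u y ^+ 2) ^+ 2))%E ->
  (\int[mu]_(y in setT) F y <= (a * 35)%:E * inv_root4 (dotv u w ^+ 2))%E.
Proof.
move=> d2 unif w1 u1 a0 F0 Fu.
have [e [s [e1 ew uE]]] := orth_decomposition u (ltnW d2) w1.
apply: (circle_integral_le d2 unif e1 ew) => //; first exact: inv_root4_gt0.
move=> y yS; have [y1 yw] := orth_sphere1P yS.
have ey := dotv_sqr_le1 e1 y1.
apply: (le_trans (Fu y yS)).
rewrite -muleA -inv_root4M ?sqr_ge0 ?subr_ge0 //.
apply: lee_wpmul2l; first by rewrite lee_fin ltW.
apply: inv_root4_le.
have -> : dotv u y = s * dotv e y by rewrite uE !dotv_linE (dotvC w) yw mulr0 add0r.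
have cs : dotv u w ^+ 2 = 1 - s ^+ 2.
  have := u1; rewrite {1 2}uE !dotv_linE w1 e1 ew (dotvC w e) ew !expr2; lra.
have c0 := sqr_ge0 (dotv u w).
have p0 := sqr_ge0 (dotv e y).
rewrite cs in c0 *; rewrite exprMn expr2.
have s0 := sqr_ge0 s.
by apply: ler_pM; nra.
Qed.

(** Parseval's identity for [u] in the orthonormal basis [e], [f], [w] of three-space, whose third
    coordinate vanishes. *)
Lemma dotv_sqr_circle e f w u : d = 3 -> dotv e e = 1 -> dotv f f = 1 -> dotv w w = 1 ->
  dotv e f = 0 -> dotv e w = 0 -> dotv f w = 0 -> dotv u u = 1 -> dotv u w = 0 ->
  dotv e u ^+ 2 = 1 - dotv f u ^+ 2.
Proof.
move=> d3; subst d => e1 f1 w1 ef ew fw u1 uw.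
pose O : 'M[R]_3 := \matrix_(i, j) (if i == 0 then e else if i == 1 then f else w) 0 j.
have rO (v : 'rV[R]_3) i :
    (v *m O^T) 0 i = dotv v (if i == 0 then e else if i == 1 then f else w).
  by rewrite mxE dotvE; apply: eq_bigr => j _; rewrite !mxE.
have OO : O *m O^T = 1%:M.
  apply/matrixP => i j.
  have -> : (O *m O^T) i j = dotv (row i O) (if j == 0 then e else if j == 1 then f else w).
    by rewrite -rO -row_mul [in RHS]mxE.
  have -> : row i O = (if i == 0 then e else if i == 1 then f else w).
    by apply/rowP => l; rewrite !mxE.
  rewrite mxE; case: i => [[|[|[|//]]] ?]; case: j => [[|[|[|//]]] ?];
    by rewrite /= ?e1 ?f1 ?w1 ?ef ?ew ?fw // dotvC ?ef ?ew ?fw.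
have O'O : O^T *m O = 1%:M by exact: mulmx1C.
have := u1; have -> : dotv u u = dotv (u *m O^T) (u *m O^T).
  by rewrite /dotv trmx_mul trmxK mulmxA -(mulmxA u) O'O mulmx1.
rewrite dotvE !big_ord_recl big_ord0 !rO /= uw (dotvC u e) (dotvC u f) !expr2; lra.
Qed.

(** With [e] the direction of the projection of [u] to the plane of the circle and [f] orthogonal to
    [e] in that plane, [dotv u y ^+ 2] equals [(1 - dotv u z ^+ 2) * (1 - dotv f y ^+ 2)]. The first
    factor leaves the integral, the second is the cap weight around [f]. *)
Lemma dotv_integral_le mu z u (a : R) (F : Rd R d -> \bar R) :
  d = 3 -> uniform_on_orth_sphere [:: z] mu -> dotv z z = 1 -> dotv u u = 1 ->
  0 < a -> (forall y, 0 <= F y)%E ->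
  (forall y, orth_sphere [:: z] y -> F y <= a%:E * inv_root4 (dotv u y ^+ 2))%E ->
  (\int[mu]_(y in setT) F y <= (a * 35)%:E * inv_root4 (1 - dotv u z ^+ 2))%E.
Proof.
move=> d3 unif z1 u1 a0 F0 Fu.
have d2 : (2 < d)%N by rewrite d3.
have [e [s [e1 ez uE]]] := orth_decomposition u (ltnW d2) z1.
have [f [f1 fo]] := @exists_unit_orth R d [:: z; e] d2.
have fz : dotv f z = 0 by apply: fo; rewrite !inE eqxx.
have ef : dotv e f = 0 by rewrite dotvC; apply: fo; rewrite !inE eqxx orbT.
apply: (circle_integral_le d2 unif f1 fz) => //; first exact: inv_root4_gt0.
move=> y yS; have [y1 yz] := orth_sphere1P yS.
apply: (le_trans (Fu y yS)).
rewrite -muleA -inv_root4M ?subr_ge0 ?dotv_sqr_le1 //.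
suff -> : dotv u y ^+ 2 = (1 - dotv u z ^+ 2) * (1 - dotv f y ^+ 2) by [].
rewrite -(dotv_sqr_circle d3 e1 f1 z1 ef ez fz y1 yz).
have -> : dotv u y = s * dotv e y by rewrite uE !dotv_linE (dotvC z) yz mulr0 add0r.
rewrite exprMn; congr (_ * _).
have := u1; rewrite {1 2}uE !dotv_linE z1 e1 ez (dotvC z e) ez !expr2; lra.
Qed.

(** Here the exponent is only 1/4, so the circle estimate already gives a constant, after [u] is
    replaced by its normalized projection [e]. *)
Lemma cap_singular_integral_le mu w u (a : R) (F : Rd R d -> \bar R) :
  (2 < d)%N -> uniform_on_orth_sphere [:: w] mu -> dotv w w = 1 -> dotv u u = 1 ->
  0 < a -> (forall y, 0 <= F y)%E ->
  (forall y, orth_sphere [:: w] y -> F y <= a%:E * inv_root4 (1 - dotv u y ^+ 2))%E ->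
  (\int[mu]_(y in setT) F y <= (a * 35)%:E)%E.
Proof.
move=> d2 unif w1 u1 a0 F0 Fu.
have [e [s [e1 ew uE]]] := orth_decomposition u (ltnW d2) w1.
rewrite -[leRHS]mule1.
apply: (circle_integral_le d2 unif e1 ew) => // y yS.
have [y1 yw] := orth_sphere1P yS.
rewrite mule1; apply: (le_trans (Fu y yS)); apply: lee_wpmul2l; first by rewrite lee_fin ltW.
apply: inv_root4_le.
have s1 : s ^+ 2 <= 1.
  have := u1; rewrite {1 2}uE !dotv_linE w1 e1 ew (dotvC w e) ew => h.
  by have := sqr_ge0 (dotv u w); rewrite !expr2; lra.
have -> : dotv u y = s * dotv e y by rewrite uE !dotv_linE (dotvC w) yw mulr0 add0r.
by rewrite lerB // exprMn ler_piMl // sqr_ge0.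
Qed.

End singular_integrals.

(** * Sphere areas and small Gram determinants *)

Lemma sphere_area_gt0 {R : realType} (n : nat) : 0 < sphere_area n :> R.
Proof.
suff [] : 0 < sphere_area n :> R /\ 0 < sphere_area n.+1 :> R by [].
elim: n => [|n [IH1 IH2]]; first by split; rewrite /= ?mulr_gt0 ?pi_gt0 ?ltr0n.
by split=> //=; rewrite mulr_gt0 // divr_gt0 ?ltr0n // mulr_gt0 ?pi_gt0.
Qed.

Section Det_small.
Context {R : realType} {d : nat}.
Implicit Types x y : 'rV[R]_d.

Lemma Det_nil : Det ([::] : seq 'rV[R]_d) = 1.
Proof. by rewrite /Det det_mx00 sqrtr1. Qed.

Lemma Det_unit x : dotv x x = 1 -> Det [:: x] = 1.
Proof. by move=> x1; rewrite /Det det_mx11 mxE /= x1 sqrtr1. Qed.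

Lemma Det_unit_pair x y : dotv x x = 1 -> dotv y y = 1 ->
  Det [:: x; y] = Num.sqrt (1 - dotv x y ^+ 2).
Proof.
move=> x1 y1; rewrite /Det; congr Num.sqrt.
rewrite (expand_det_row _ ord0) /= !big_ord_recl big_ord0 /cofactor !det_mx11 !mxE /=.
by rewrite x1 y1 (dotvC y x) /=; ring.
Qed.

Lemma Det_ge0 (ys : seq 'rV[R]_d) : 0 <= Det ys.
Proof. exact: sqrtr_ge0. Qed.

End Det_small.

(** * Earlier neighbours in the cycle *)

Section cycle_neighbours.
Context {R : realType} {d : nat}.
Variables (k : nat) (xs : seq 'rV[R]_d).

Lemma prev_nbrs_cycle_first : prev_nbrs (cycle_rel k) 0 xs = [::].
Proof. by []. Qed.

Lemma prev_nbrs_cycle_inner v : (v.+2 < k)%N ->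
  prev_nbrs (cycle_rel k) v.+1 xs = [:: xs`_v].
Proof.
move=> vk; rewrite /prev_nbrs.
have E w : (w < v.+1)%N -> cycle_rel k v.+1 w = (w == v).
  move=> wv; have wk : (w.+1 < k)%N by exact: leq_ltn_trans wv (ltnW vk).
  rewrite /cycle_rel (ltnW vk) (ltnW wk) /= !modn_small //.
  by rewrite (ltn_eqF (ltnW wv : w < v.+2)%N) eqSS eq_sym.
rewrite -[v.+1]addn1 iotaD filter_cat map_cat /= addn1 E // eqxx /=.
rewrite (@eq_in_filter _ _ pred0) ?filter_pred0 // => w.
rewrite mem_iota add0n => /andP[_ wv].
by rewrite E ?ltn_eqF // ltnW.
Qed.

Lemma prev_nbrs_cycle_last v : k = v.+3 ->
  prev_nbrs (cycle_rel k) v.+2 xs = [:: xs`_0; xs`_v.+1].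
Proof.
move=> kv; rewrite /prev_nbrs.
have E w : (w < v.+2)%N -> cycle_rel k v.+2 w = (w == 0)%N || (w == v.+1).
  move=> wv; rewrite /cycle_rel kv ltnSn (ltn_trans wv) //= modnn.
  by rewrite modn_small // eqSS (eq_sym v.+1).
have -> : iota 0 v.+2 = 0%N :: (iota 1 v ++ [:: v.+1]).
  by have := iotaD 1 v 1; rewrite addn1 add1n => <-.
rewrite /= filter_cat /=.
rewrite !E // eqxx /=.
rewrite (@eq_in_filter _ _ pred0 (iota 1 v)) ?filter_pred0 ?eqxx // => w.
rewrite mem_iota add1n => /andP[w0 wv].
by rewrite E ?(gtn_eqF w0) ?(ltn_eqF wv) // ltnW.
Qed.

End cycle_neighbours.

(** * The iterated integral over walks on the sphere *)

Section cycle_density.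
Context {R : realType} {d : nat} (k : nat).
Variable sigma : seq 'rV[R]_d -> probability (Rd R d) R.
Hypotheses (d3 : (3 <= d)%N) (k3 : (3 <= k)%N) (unif : uniform_family sigma).
Local Notation E := (cycle_rel k).
Local Notation F := (@ortho_integrand R d E k).
Local Notation I := (seq_orth_int sigma E).

(** The invariant of prefixes of length at most [k.-1]. The edge closing the cycle involves only the
    last vertex and does not appear. *)
Definition orth_walk (xs : seq 'rV[R]_d) : Prop :=
  (forall i, (i < size xs)%N -> dotv xs`_i xs`_i = 1) /\
  (forall i, (i.+1 < size xs)%N -> dotv xs`_i.+1 xs`_i = 0).

Lemma ortho_integrand_ge0 xs : (0 <= F xs)%E.
Proof.
apply: mule_ge0.
  rewrite lee_fin divr_ge0 ?exprn_ge0 ?exprz_ge0 //; apply: ltW; exact: sphere_area_gt0.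
apply: prode_ge0 => v _ /=; case: ifP => _; first exact: le0y.
by rewrite lee_fin divr_ge0 ?Det_ge0 // ltW // sphere_area_gt0.
Qed.

Lemma seq_orth_int_ge0 m xs : (0 <= I m xs F)%E.
Proof.
elim: m xs => [|m IH] xs /=; first exact: ortho_integrand_ge0.
by apply: integral_ge0 => y _; exact: IH.
Qed.

Lemma ortho_integrand_le : exists2 M : R, 0 < M & forall xs,
  (forall i, (i < k.-1)%N -> dotv xs`_i xs`_i = 1) ->
  (F xs <= M%:E * inv_root4 ((1 - dotv xs`_0 xs`_k.-2 ^+ 2) ^+ 2))%E.
Proof.
have Ak n := @sphere_area_gt0 R n.
(* Vertex 0 has no earlier neighbour and each of the vertices [1] to [k.-2] has exactly one, of unit
   length, so their factors are these constants. *)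
pose c (v : nat) : R := sphere_area (d - (v != 0)%N).-1.
pose b : R := sphere_area d.-1 ^ ((nedges E k)%:Z - k%:Z) / sphere_area d.-2 ^+ nedges E k.
have b0 : 0 < b by apply: divr_gt0; [apply: exprz_gt0|apply: exprn_gt0].
have p0 : 0 < \prod_(v < k.-1) c v by apply: prodr_gt0 => v; rewrite Ak.
exists (b * (\prod_(v < k.-1) c v * sphere_area (d - 2).-1)); first by rewrite mulr_gt0 // mulr_gt0.
move=> xs xs1; rewrite /ortho_integrand -/b [in leRHS]EFinM -muleA.
apply: lee_wpmul2l; first by rewrite lee_fin ltW.
case: k k3 xs1 @c p0 => [|[|[|v]]] // _ xs1 c p0.
rewrite big_ord_recr /= prev_nbrs_cycle_last // [in leRHS]EFinM -muleA.
have -> : (\prod_(i < v.+2) (let ys := prev_nbrs (cycle_rel v.+3) i xs in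
    if Det ys == 0%R then +oo else (sphere_area (d - size ys).-1 / Det ys)%:E) =
    (\prod_(i < v.+2) c i)%:E)%E.
  rewrite -prodEFin; apply: eq_bigr => -[[|i] iv] _ /=.
    by rewrite prev_nbrs_cycle_first Det_nil oner_eq0 divr1.
  rewrite prev_nbrs_cycle_inner // Det_unit ?oner_eq0 ?divr1 //.
  by apply: xs1; exact: ltnW.
apply: lee_wpmul2l; first by rewrite lee_fin ltW.
have x0 := xs1 0%N isT; have xv := xs1 v.+1 (ltnSn _).
rewrite Det_unit_pair //=; set q := 1 - _.
have : 0 <= q by rewrite subr_ge0 dotv_sqr_le1.
(* If [x_0] and [x_(k-2)] are parallel, the determinant vanishes and the right-hand side is [+oo] as
   well. *)
rewrite le0r => /orP[/eqP ->|q0].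
  by rewrite expr0n /inv_root4 lexx gt0_muley ?lte_fin // leey.
by rewrite gt_eqF ?sqrtr_gt0 // inv_root4_sqr.
Qed.

Lemma orth_walk_rcons xs y : orth_walk xs -> dotv y y = 1 ->
  ((0 < size xs)%N -> dotv y xs`_(size xs).-1 = 0) -> orth_walk (rcons xs y).
Proof.
move=> [xs1 xso] y1 yo; split => i; rewrite size_rcons ltnS => ix.
  rewrite !nth_rcons; move: ix; rewrite leq_eqVlt => /orP[/eqP ->|ix].
    by rewrite ltnn eqxx.
  by rewrite ix xs1.
rewrite !nth_rcons ix; move: ix; rewrite leq_eqVlt => /orP[/eqP ix|ix].
  by rewrite ix ltnn eqxx; move: yo; rewrite -ix; apply.
by rewrite ix xso.
Qed.

Lemma orth_walk_step xs (y : Rd R d) : orth_walk xs -> (0 < size xs)%N ->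
  orth_sphere [:: xs`_(size xs).-1] y -> orth_walk (rcons xs y).
Proof. by move=> gxs x0 /orth_sphere1P[y1 yx]; apply: orth_walk_rcons. Qed.

Lemma seq_orth_int_step xs m : (0 < size xs)%N -> (size xs < k.-1)%N ->
  I m.+1 xs F =
  (\int[sigma [:: xs`_(size xs).-1]]_(y in [set: Rd R d]) I m (rcons xs y) F)%E.
Proof.
move=> x0 xk; rewrite /=; congr (integral (sigma _) _ _).
rewrite -{1}(prednK x0) prev_nbrs_cycle_inner // prednK //.
by move: xk; case: k k3 => [|?] //= _.
Qed.

Lemma seq_orth_int_const xs m (c : \bar R) : orth_walk xs -> (size xs < k.-1)%N ->
  (0 <= c)%E ->
  (forall y, orth_walk (rcons xs y) -> I m (rcons xs y) F <= c)%E ->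
  (I m.+1 xs F <= c)%E.
Proof.
(* Vertex 0 is uniform on the whole sphere; every later one has a single predecessor. *)
move=> gxs xk c0 Ic; have [x0|x0] := posnP (size xs).
  rewrite /= x0 prev_nbrs_cycle_first.
  apply: (integral_le_cst (orth_sphere_measurable [::]) _ _ c0) => //.
  - exact: (unif (ys := [::]) (ltn_trans (isT : 0 < 2)%N d3)).1.
  - by move=> y; exact: seq_orth_int_ge0.
  by move=> y [y1 _]; apply: Ic; apply: orth_walk_rcons => //; rewrite x0.
rewrite seq_orth_int_step //.
apply: (integral_le_cst (orth_sphere_measurable [:: xs`_(size xs).-1]) _ _ c0).
- exact: (unif (ys := [:: _]) (ltn_trans (isT : 1 < 2)%N d3)).1.
- by move=> y; exact: seq_orth_int_ge0.
by move=> y yS; apply: Ic; exact: orth_walk_step.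
Qed.

(** A bound valid for all walks of length [n] descends, one probability average at a time, to the
    empty walk. *)
Lemma ortho_density_le_const n (c : \bar R) : (n <= k.-1)%N -> (0 <= c)%E ->
  (forall xs, orth_walk xs -> size xs = n -> I (k - n) xs F <= c)%E ->
  (ortho_density sigma E k <= c)%E.
Proof.
move=> + c0; elim: n => [_ Ic|n IH nk Ic].
  by rewrite /ortho_density -[X in seq_orth_int _ _ X]subn0; apply: Ic => //; split.
apply: IH; first exact: ltnW.
move=> xs gxs sx.
have -> : (k - n = (k - n.+1).+1)%N.
  by rewrite subnS prednK // subn_gt0 (leq_trans nk) // leq_pred.
apply: seq_orth_int_const => //; first by rewrite sx.
by move=> y gy; apply: Ic => //; rewrite size_rcons sx.
Qed.

(** The bound of [ortho_integrand_le] does not involve the last vertex, so averaging over that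
    vertex preserves it. *)
Lemma seq_orth_int_last : exists2 M : R, 0 < M & forall xs,
  orth_walk xs -> size xs = k.-1 ->
  (I 1 xs F <= M%:E * inv_root4 ((1 - dotv xs`_0 xs`_k.-2 ^+ 2) ^+ 2))%E.
Proof.
have [M M0 HM] := ortho_integrand_le; exists M => // xs [xs1 _] sx /=.
apply: (@integral_le_cst _ _ _ _ setT) => //.
- exact: probability_setT.
- by move=> y; exact: ortho_integrand_ge0.
- by rewrite mule_ge0 ?lee_fin ?ltW // inv_root4_gt0.
have nr y i : (i < k.-1)%N -> (rcons xs y)`_i = xs`_i by rewrite nth_rcons sx => ->.
have k20 : (0 < k.-1)%N by rewrite -ltnS prednK ?(leq_trans _ k3).
have k2 : (k.-2 < k.-1)%N by rewrite ltn_predL.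
move=> y _; apply: (le_trans (HM (rcons xs y) _)); last by rewrite !nr.
by move=> i ik; rewrite nr // xs1 // sx.
Qed.

End cycle_density.

(** * Averaging out the last vertices of a cycle of length [k.+3] *)

Section cycle_density_finite.
Context {R : realType} {d : nat} (k : nat).
Variable sigma : seq 'rV[R]_d -> probability (Rd R d) R.
Hypotheses (d3 : (3 <= d)%N) (unif : uniform_family sigma).
Local Notation E := (cycle_rel k.+3).
Local Notation F := (@ortho_integrand R d E k.+3).
Local Notation I := (seq_orth_int sigma E).
Variable M : R.
Hypothesis M0 : 0 < M.
Hypothesis HM : forall xs, orth_walk xs -> size xs = k.+2 ->
  (I 1 xs F <= M%:E * inv_root4 ((1 - dotv xs`_0 xs`_k.+1 ^+ 2) ^+ 2))%E.

Let unif1 w : uniform_on_orth_sphere [:: w] (sigma [:: w]).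
Proof. by apply: unif; exact: ltn_trans d3. Qed.

Let last_vertex xs (y : Rd R d) : orth_walk xs -> size xs = k.+1 ->
  orth_sphere [:: xs`_k] y ->
  (I 1 (rcons xs y) F <= M%:E * inv_root4 ((1 - dotv xs`_0 y ^+ 2) ^+ 2))%E.
Proof.
move=> gxs sx yS.
have := @HM (rcons xs y); rewrite size_rcons sx !nth_rcons sx ltnn eqxx /=.
by apply=> //; apply: orth_walk_step; rewrite ?sx.
Qed.

Lemma ortho_density_cycle_lty_gt3 : (3 < d)%N -> (ortho_density sigma E k.+3 < +oo)%E.
Proof.
move=> d4.
suff : (ortho_density sigma E k.+3 <= (M * 35)%:E)%E.
  by move=> /le_lt_trans; apply; exact: ltry.
apply: (ortho_density_le_const (k := k.+3) d3 isT unif (n := k.+1)) => //.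
  by rewrite lee_fin mulr_ge0 // ltW.
move=> xs gxs sx; rewrite -[k.+3]/(2 + k.+1)%N addnK.
rewrite seq_orth_int_step ?sx //.
apply: (singular_integral_le_sphere (u := xs`_0) d4 (unif1 _)) => //.
- by apply: gxs.1; rewrite sx.
- by apply: gxs.1; rewrite sx.
- by move=> y; exact: seq_orth_int_ge0.
- by move=> y; exact: last_vertex.
Qed.

(** Averaging over [x_(k+1)] on the subsphere orthogonal to [x_k] turns the exponent -1/2 of the
    last factor into [|dotv x_0 x_k| ^ (-1/2)]. *)
Lemma seq_orth_int_2_le xs : orth_walk xs -> size xs = k.+1 ->
  (I 2 xs F <= (M * 35)%:E * inv_root4 (dotv xs`_0 xs`_k ^+ 2))%E.
Proof.
move=> gxs sx; rewrite seq_orth_int_step ?sx //.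
apply: (singular_integral_le_circle d3 (unif1 _)) => //.
- by apply: gxs.1; rewrite sx.
- by apply: gxs.1; rewrite sx.
- by move=> y; exact: seq_orth_int_ge0.
- by move=> y; exact: last_vertex.
Qed.

Lemma seq_orth_int_3_le xs (j : nat) : d = 3 -> k = j.+1 -> orth_walk xs -> size xs = k ->
  (I 3 xs F <= (M * 35 * 35)%:E * inv_root4 (1 - dotv xs`_0 xs`_j ^+ 2))%E.
Proof.
move=> d3' kj gxs sx.
have sx0 : (0 < size xs)%N by rewrite sx kj.
have sxk : (size xs < k.+3.-1)%N by rewrite sx ltnW.
have sj : (size xs).-1 = j by rewrite sx kj.
rewrite seq_orth_int_step // sj.
apply: (dotv_integral_le d3' (unif1 _)).
- by apply: gxs.1; rewrite sx kj.
- by apply: gxs.1; rewrite sx kj.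
- by rewrite mulr_gt0.
- by move=> y; exact: seq_orth_int_ge0.
move=> y yS; have := @seq_orth_int_2_le (rcons xs y).
have -> : (rcons xs y)`_0 = xs`_0 by rewrite nth_rcons sx kj.
have -> : (rcons xs y)`_k = y by rewrite nth_rcons sx ltnn eqxx.
rewrite size_rcons sx; apply=> //.
by apply: orth_walk_step; rewrite ?sj.
Qed.

Lemma seq_orth_int_4_le xs (j : nat) : d = 3 -> k = j.+2 -> orth_walk xs -> size xs = j.+1 ->
  (I 4 xs F <= (M * 35 * 35 * 35)%:E)%E.
Proof.
move=> d3' kj gxs sx.
have sxk : (size xs < k.+3.-1)%N by rewrite sx kj; do 2 apply: ltnW.
have sx0 : (0 < size xs)%N by rewrite sx.
have sj : (size xs).-1 = j by rewrite sx.
rewrite seq_orth_int_step // sj.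
apply: (cap_singular_integral_le (u := xs`_0) d3 (unif1 _)).
- by apply: gxs.1; rewrite sx.
- by apply: gxs.1; rewrite sx.
- by rewrite !mulr_gt0.
- by move=> y; exact: seq_orth_int_ge0.
move=> y yS; have := @seq_orth_int_3_le (rcons xs y) _ d3' kj.
rewrite size_rcons sx !nth_rcons sx ltnn eqxx kj /=; apply=> //.
by apply: orth_walk_step; rewrite ?sj.
Qed.

End cycle_density_finite.

Theorem theorem20 (R : realType) (d k : nat)
    (sigma : seq 'rV[R]_d -> probability (Rd R d) R) :
  (3 <= d)%N -> (3 <= k)%N -> (d, k) != (3%N, 4%N) ->
  uniform_family sigma ->
  (@ortho_density R d sigma (cycle_rel k) k < +oo)%E.
Proof.
move=> d3 k3 dk unif.
have [M M0 HM] := seq_orth_int_last sigma k3.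
case: k k3 dk HM => [|[|[|k]]] // _ dk HM.
have [d4|d3'] := ltnP 3 d.
  exact: (ortho_density_cycle_lty_gt3 d3 unif M0 HM d4).
have {d3'}d3' : d = 3 by apply/eqP; rewrite eqn_leq d3' d3.
have lty (n : nat) (c : R) : (n <= k.+2)%N -> 0 <= c ->
    (forall xs, orth_walk xs -> size xs = n ->
      seq_orth_int sigma (cycle_rel k.+3) (k.+3 - n) xs
        (@ortho_integrand R d (cycle_rel k.+3) k.+3) <= c%:E)%E ->
    (ortho_density sigma (cycle_rel k.+3) k.+3 < +oo)%E.
  move=> nk c0 h; apply: le_lt_trans (ltry c).
  exact: (ortho_density_le_const (k := k.+3) d3 isT unif nk).
have orth01 (xs : seq 'rV[R]_d) : orth_walk xs -> size xs = 2 -> dotv xs`_0 xs`_1 = 0.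
  by move=> gxs sx; rewrite dotvC; apply: gxs.2; rewrite sx.
(* In dimension 3 the cycle lengths 3, 4, 5 and at least 6 are separated. *)
case: k => [|[|[|k]]] in dk HM lty *.
- apply: (lty 2%N M) => //; first exact: ltW.
  move=> xs gxs sx; apply: (le_trans (HM xs gxs sx)).
  by rewrite orth01 // expr0n subr0 expr1n inv_root4_1 mule1.
(* The excluded pair: for length 4, [seq_orth_int_2_le] gives only [+oo], since [x_1] is orthogonal
   to [x_0]. *)
- by rewrite d3' eqxx in dk.
- apply: (lty 2%N (M * 35 * 35)) => //; first by rewrite !mulr_ge0 // ltW.
  move=> xs gxs sx.
  apply: (le_trans (seq_orth_int_3_le d3 unif M0 HM d3' (erefl _) gxs sx)).
  by rewrite orth01 // expr0n subr0 inv_root4_1 mule1.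
apply: (lty k.+2 (M * 35 * 35 * 35)) => //; first by do 2 apply: ltnW.
  by rewrite !mulr_ge0 // ltW.
move=> xs gxs sx; rewrite -[k.+3.+3]/(4 + k.+2)%N addnK.
exact: (seq_orth_int_4_le d3 unif M0 HM d3' (erefl _) gxs sx).
Qed.
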